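(* Let $r\in\mathbb{N}$ ($r\ge1$) and $p\in\mathbb{Z}$ be fixed and let $A$ be a positive integer. For $q\in\mathbb{N}$ put $x_+(q)=\frac{-p+\sqrt{p^2+4rq}}{2r}=[a_0;a_1,a_2,\ldots]$. For $n,R\in\mathbb{N}$ let $q$ be chosen uniformly at random from $\{1,\ldots,R\}$ and, independently, $s$ uniformly at random from $\{1,\ldots,n\}$, and let $\pi_{R,n}(A)$ be the probability that the $s$-th partial quotient $a_s$ of $x_+(q)$ equals $A$. Then for every $n$ the limit $\lim_{R\to\infty}\pi_{R,n}(A)$ exists, and $$\lim_{R\to\infty}\pi_{R,n}(A)=\frac{\ln\left(1+\frac{1}{A(A+2)}\right)}{\ln 2}+O\!\left(\frac1n\right)\qquad (n\to\infty).$$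
   Context: Every real number $x$ is written as a regular continued fraction $x=[a_0;a_1,a_2,\ldots]$ with $a_0\in\mathbb{Z}$ and $a_i\in\mathbb{N}$, $a_i\ge1$, for $i\ge 1$ (for rational $x$ the expansion is finite; take the standard one, in which the last partial quotient is at least $2$ unless $x$ is an integer, and ''$a_s=A$'' is false if $a_s$ does not exist). *)

(* Defs.v *)
From HB Require Import structures.
From mathcomp Require Import all_boot all_order all_algebra.
From mathcomp Require Import all_classical all_reals all_analysis.

Set Implicit Arguments.
Unset Strict Implicit.
Unset Printing Implicit Defensive.

Import Order.TTheory GRing.Theory Num.Theory.
Import numFieldNormedType.Exports.

Local Open Scope classical_set_scope.
Local Open Scope ring_scope.

(** Regular continued fraction x = [a_0; a_1, a_2, ...].  The complete quotients
    are x_0 = x and x_(i+1) = 1 / (x_i - floor x_i), and a_i = floor x_i.  The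
    expansion stops (value [None] from then on) after the first integral x_i, so
    a rational x gets its finite expansion, whose last partial quotient is an
    integer x_i > 1 unless i = 0. *)

Definition next_quotient (R : realType) (y : R) : option R :=
  if y == (Num.floor y)%:~R then None else Some (y - (Num.floor y)%:~R)^-1.

Fixpoint complete_quotient (R : realType) (x : R) (i : nat) : option R :=
  if i is j.+1 then obind (@next_quotient R) (complete_quotient x j)
  else Some x.

Definition partial_quotient (R : realType) (x : R) (i : nat) : option int :=
  omap Num.floor (complete_quotient x i).

Definition xplus (R : realType) (r : nat) (p : int) (q : nat) : R :=
  (- p%:~R + Num.sqrt (p%:~R ^+ 2 + 4 * r%:R * q%:R)) / (2 * r%:R).

Definition uniform_prob (R : realType) (T : finType) (E : pred T) : R :=
  #|E|%:R / #|T|%:R.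

(** A pair (q, s) uniform on {1..N} x {1..n} is the same as q and s independent
    and uniform.  Ordinals start at 0, hence the successors. *)
Definition pi_prob (R : realType) (r : nat) (p : int) (A N n : nat) : R :=
  uniform_prob R
    [pred qs : 'I_N * 'I_n |
      partial_quotient (xplus R r p qs.1.+1) qs.2.+1 == Some A%:Z].

(* Main.v *)
Require Import Defs.
From HB Require Import structures.
From mathcomp Require Import all_boot all_order all_algebra.
From mathcomp Require Import all_classical all_reals all_analysis.
From mathcomp Require Import ring lra zify.

Set Implicit Arguments.
Unset Strict Implicit.
Unset Printing Implicit Defensive.

Import Order.TTheory GRing.Theory Num.Theory.
Import numFieldNormedType.Exports.

Local Open Scope classical_set_scope.
Local Open Scope ring_scope.

(** Put h_t(c) = (1 + c) t / (1 + c t) and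
    (U h)(c) = sum_(a >= 1) (1 + c) / ((a + c) (a + c + 1)) h(1 / (a + c)).
    If a point of [0, 1] has distribution function t |-> h_t(c), then its image
    under k steps of the Gauss map has distribution function t |-> (U^k h_t)(c).
    Since U multiplies Lipschitz constants by at most 7/8, (U^k h_t)(c) depends on
    c up to (7/8)^k only.  The Gauss law ln (1 + t) / ln 2 is invariant and is a
    mixture of the h_t(c), approximated here by Riemann sums, so it is within
    (7/8)^k of (U^k h_t)(0), the law after k steps of a uniform point.

    The fractional parts of x_+(q) are equidistributed, because f(x_+(q)) = q for
    f(y) = r y^2 + p y, which is integral at integers: on each block
    f(K) <= q < f(K + 1) the count is off by O(1), and there are O(sqrt R) blocks.
    Splitting according to the next digit transports the limiting frequencies
    along the Gauss map, so lim_R P(a_s = A) differs from the Gauss-Kuzmin value by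
    O((7/8)^s), and averaging over s <= n leaves O(1/n). *)

(** * The operator U and its contraction *)

(** The sum of [weight j c] over [j >= i]: the conditional probability, given the parameter [c],
    that the next digit is at least [i + 1]. *)
Definition tail_weight (R : realType) (i : nat) (c : R) : R :=
  (1 + c) / (i.+1%:R + c).

Definition weight (R : realType) (i : nat) (c : R) : R :=
  tail_weight i c - tail_weight i.+1 c.

(** Index [i] stands for the digit [i + 1]. The value of [limn] is meaningful for [h] bounded on
    [0, 1], by [gauss_op_cvg]. *)
Definition gauss_op (R : realType) (h : R -> R) (c : R) : R :=
  limn (series (fun i => weight i c * h (i.+1%:R + c)^-1)).

Definition bounded01 (R : realType) (h : R -> R) : Prop :=
  exists B : R, forall c, 0 <= c <= 1 -> `|h c| <= B.

Definition lipschitz01 (R : realType) (L : R) (h : R -> R) : Prop :=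
  forall c d, 0 <= c <= 1 -> 0 <= d <= 1 -> `|h c - h d| <= L * `|c - d|.

Lemma inv_shift01 (R : realType) (i : nat) (c : R) :
  0 <= c -> 0 <= (i.+1%:R + c)^-1 <= 1.
Proof.
move=> c0; have i0 : (0 : R) <= i%:R by [].
rewrite -natr1 invr_ge0 invf_le1; lra.
Qed.

Lemma inv_nat01 (R : realType) (a : nat) :
  (0 < a)%N -> 0 <= (a%:R^-1 : R) <= 1.
Proof.
by move=> a0; rewrite invr_ge0 ler0n /= invf_le1 ?ltr0n// ler1n.
Qed.

Lemma tail_weight0 (R : realType) (c : R) : 0 <= c -> tail_weight 0 c = 1.
Proof. by move=> c0; rewrite /tail_weight divff// lt0r_neq0//; lra. Qed.

Lemma tail_weight_ge0 (R : realType) (i : nat) (c : R) :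
  0 <= c -> 0 <= tail_weight i c.
Proof. by move=> c0; rewrite divr_ge0 ?addr_ge0. Qed.

Lemma weightE (R : realType) (i : nat) (c : R) : 0 <= c ->
  weight i c = (1 + c) / ((i.+1%:R + c) * (i.+2%:R + c)).
Proof.
move=> c0; have i0 : (0 : R) <= i%:R by [].
by rewrite /weight /tail_weight -!natr1; field; rewrite !lt0r_neq0//; lra.
Qed.

Lemma weight_ge0 (R : realType) (i : nat) (c : R) : 0 <= c -> 0 <= weight i c.
Proof. by move=> c0; rewrite weightE// divr_ge0 ?mulr_ge0// addr_ge0. Qed.

Lemma sum_weight (R : realType) (c : R) (m n : nat) : (m <= n)%N ->
  \sum_(m <= i < n) weight i c = tail_weight m c - tail_weight n c.
Proof.
move=> mn; rewrite (telescope_sumr_eq (fun i => - tail_weight i c)) //.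
  by rewrite opprK addrC.
by move=> i _; rewrite opprK addrC.
Qed.

Lemma tail_weight_cvg0 (R : realType) (c : R) : 0 <= c <= 1 ->
  tail_weight i c @[i --> \oo] --> 0.
Proof.
move=> c01; apply: (@squeeze_cvgr _ _ _ _ (fun=> 0) (fun i => 2 * harmonic i)).
- near=> i; rewrite tail_weight_ge0 /=; last lra.
  have i0 : (0 : R) <= i%:R by [].
  rewrite /tail_weight /harmonic -natr1 ler_pdivrMr; last lra.
  have : 0 <= c / (i%:R + 1) by rewrite divr_ge0; lra.
  rewrite (_ : 2 / (i%:R + 1) * _ = 2 + 2 * (c / (i%:R + 1))); first lra.
  by field; rewrite lt0r_neq0//; lra.
- exact: cvg_cst.
- by rewrite -[X in _ --> X](mulr0 2); apply: cvgMl_tmp; exact: cvg_harmonic.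
Unshelve. all: by end_near. Qed.

Lemma cvg_sum_weight (R : realType) (c : R) : 0 <= c <= 1 ->
  series (fun i => weight i c) @ \oo --> (1 : R).
Proof.
move=> c01; rewrite (_ : series _ = fun n => 1 - tail_weight n c).
  by rewrite -[X in _ --> X]subr0; apply: cvgB;
    [exact: cvg_cst | exact: tail_weight_cvg0].
by apply/funext => n; rewrite /series /= sum_weight// tail_weight0//; lra.
Qed.

Lemma gauss_op_cvg (R : realType) (h : R -> R) (c : R) :
  bounded01 h -> 0 <= c <= 1 ->
  series (fun i => weight i c * h (i.+1%:R + c)^-1) @ \oo --> gauss_op h c.
Proof.
move=> [B hB] c01; have c0 : 0 <= c by lra.
apply: normed_cvg; apply: (series_le_cvg (v_ := fun i => B * weight i c)).
- by move=> n; exact: normr_ge0.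
- move=> n; rewrite mulr_ge0 ?weight_ge0//.
  by rewrite (le_trans (normr_ge0 (h c)))// hB.
- move=> n /=; rewrite normrM ger0_norm ?weight_ge0// mulrC ler_wpM2r ?weight_ge0//.
  exact/hB/inv_shift01.
- rewrite (_ : series _ = fun n => B * series (fun i => weight i c) n).
    by apply: (@cvgP _ _ (B * 1)); apply: cvgMl_tmp; exact: cvg_sum_weight.
  by apply/funext => n; rewrite /series /= big_distrr.
Qed.

Lemma gauss_op_le (R : realType) (g h : R -> R) (c : R) :
  bounded01 g -> bounded01 h -> (forall d, 0 <= d <= 1 -> g d <= h d) ->
  0 <= c <= 1 -> gauss_op g c <= gauss_op h c.
Proof.
move=> bg bh gh c01; have c0 : 0 <= c by lra.
apply: (ler_cvg_to (gauss_op_cvg bg c01) (gauss_op_cvg bh c01)).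
near=> n; apply: ler_sum => i _.
by rewrite ler_wpM2l ?weight_ge0// gh// inv_shift01.
Unshelve. all: by end_near. Qed.

Lemma gauss_op_cst (R : realType) (B c : R) :
  0 <= c <= 1 -> gauss_op (fun=> B) c = B.
Proof.
move=> c01; apply/cvg_lim => //.
rewrite (_ : series _ = fun n => B * series (fun i => weight i c) n); last first.
  by apply/funext => n; rewrite /series /= big_distrr; apply: eq_bigr => i _;
    rewrite mulrC.
by rewrite -[X in _ --> X](mulr1 B); apply: cvgMl_tmp; exact: cvg_sum_weight.
Qed.

Lemma bounded01B (R : realType) (g h : R -> R) :
  bounded01 g -> bounded01 h -> bounded01 (fun c => g c - h c).
Proof.
move=> [B gB] [C hC]; exists (B + C) => c c01.
by rewrite (le_trans (ler_normB _ _))// lerD ?gB ?hC.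
Qed.

Lemma bounded01D (R : realType) (g h : R -> R) :
  bounded01 g -> bounded01 h -> bounded01 (fun c => g c + h c).
Proof.
move=> [B gB] [C hC]; exists (B + C) => c c01.
by rewrite (le_trans (ler_normD _ _))// lerD ?gB ?hC.
Qed.

Lemma bounded01_sum (R : realType) (M : nat) (g : nat -> R -> R) :
  (forall i, bounded01 (g i)) -> bounded01 (fun c => \sum_(i < M) g i c).
Proof.
move=> bg; elim: M => [|M IH].
  by exists 0 => c _; rewrite big_ord0 normr0.
have [B hB] := bounded01D IH (bg M).
by exists B => c c01; rewrite big_ord_recr /= hB.
Qed.

Lemma gauss_opB (R : realType) (g h : R -> R) (c : R) :
  bounded01 g -> bounded01 h -> 0 <= c <= 1 ->
  gauss_op (fun d => g d - h d) c = gauss_op g c - gauss_op h c.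
Proof.
move=> bg bh c01; apply/cvg_lim => //.
rewrite (_ : series _ = fun n => series (fun i => weight i c * g (i.+1%:R + c)^-1) n
    - series (fun i => weight i c * h (i.+1%:R + c)^-1) n).
  by apply: cvgB; exact: gauss_op_cvg.
by apply/funext => n; rewrite /series /= -sumrB; apply: eq_bigr => i _; rewrite mulrBr.
Qed.

Lemma gauss_opD (R : realType) (g h : R -> R) (c : R) :
  bounded01 g -> bounded01 h -> 0 <= c <= 1 ->
  gauss_op (fun d => g d + h d) c = gauss_op g c + gauss_op h c.
Proof.
move=> bg bh c01; apply/cvg_lim => //.
rewrite (_ : series _ = fun n => series (fun i => weight i c * g (i.+1%:R + c)^-1) n
    + series (fun i => weight i c * h (i.+1%:R + c)^-1) n).
  by apply: cvgD; exact: gauss_op_cvg.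
by apply/funext => n; rewrite /series /= -big_split; apply: eq_bigr => i _;
  rewrite mulrDr.
Qed.

Lemma gauss_op_sum (R : realType) (M : nat) (g : nat -> R -> R) (c : R) :
  (forall i, bounded01 (g i)) -> 0 <= c <= 1 ->
  gauss_op (fun d => \sum_(i < M) g i d) c = \sum_(i < M) gauss_op (g i) c.
Proof.
move=> bg c01; elim: M => [|M IH].
  rewrite big_ord0 -[RHS](gauss_op_cst 0 c01); congr gauss_op.
  by apply/funext => d; rewrite big_ord0.
rewrite big_ord_recr /= -IH -gauss_opD//; last exact: bounded01_sum.
by congr gauss_op; apply/funext => d; rewrite big_ord_recr.
Qed.

(** Summation by parts. With [u i] the difference of the tail weights at [c] and [d], it trades
    differences of weights for differences of [h] at consecutive arguments. *)
Lemma abel_sum (R : comRingType) (u x : nat -> R) (n : nat) :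
  \sum_(i < n.+1) (u i - u i.+1) * x i + u n.+1 * x n =
  u 0%N * x 0%N + \sum_(i < n) u i.+1 * (x i.+1 - x i).
Proof.
elim: n => [|n IH]; first by rewrite big_ord_recr !big_ord0 /=; ring.
rewrite big_ord_recr [in RHS]big_ord_recr /= addrA -IH; ring.
Qed.

(** Used with equal indices and two parameters when the weights are fixed, and with consecutive
    indices and one parameter after summation by parts. *)
Lemma lipschitz_inv_shift (R : realType) (L : R) (h : R -> R) (i j : nat) (c d : R) :
  0 <= c <= 1 -> 0 <= d <= 1 -> lipschitz01 L h ->
  `|h (i.+1%:R + c)^-1 - h (j.+1%:R + d)^-1| <=
  L * (`|(j.+1%:R + d) - (i.+1%:R + c)| / ((i.+1%:R + c) * (j.+1%:R + d))).
Proof.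
move=> c01 d01 hL; apply: le_trans (hL _ _ _ _) _; rewrite ?inv_shift01//; try lra.
have i0 : (0 : R) <= i%:R by []. have j0 : (0 : R) <= j%:R by [].
have p : 0 < (i.+1%:R + c) * (j.+1%:R + d) by rewrite -!natr1 mulr_gt0; lra.
rewrite -[X in _ / X](gtr0_norm p) -normf_div.
suff -> : (i.+1%:R + c)^-1 - (j.+1%:R + d)^-1 =
   (j.+1%:R + d - (i.+1%:R + c)) / ((i.+1%:R + c) * (j.+1%:R + d)) by [].
by rewrite -!natr1; field; rewrite !lt0r_neq0//; lra.
Qed.

(** First half of [U h(c) - U h(d)]: the weights stay at [c] and the arguments of [h] move. The tail
    term comes from the boundary of the summation by parts; with it the weights sum to exactly 1. *)
Lemma weight_part_bound (R : realType) (L : R) (h : R -> R) (c d : R) (n : nat) :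
  0 <= L -> 0 <= c <= 1 -> 0 <= d <= 1 -> lipschitz01 L h ->
  `|\sum_(i < n.+2) weight i c * (h (i.+1%:R + c)^-1 - h (i.+1%:R + d)^-1) +
    tail_weight n.+2 c * (h (n.+2%:R + c)^-1 - h (n.+2%:R + d)^-1)|
  <= 5 / 8 * (L * `|c - d|).
Proof.
move=> L0 c01 d01 hL; set K := L * _.
pose dh i := h (i.+1%:R + c)^-1 - h (i.+1%:R + d)^-1.
rewrite -/(dh n.+1) (eq_bigr (fun i : 'I_n.+2 => weight i c * dh i))//.
have c0 : 0 <= c by lra.
have K0 : 0 <= K by rewrite mulr_ge0.
(* Digit 1 is estimated apart from the larger digits: its bound used throughout would only give the
   constant 1. *)
have dh0 : `|dh 0%N| <= K / (1 + c).
  apply: le_trans (lipschitz_inv_shift 0 0 c01 d01 hL) _.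
  rewrite /K -mulrA ler_wpM2l// opprD addrACA subrr add0r distrC ler_wpM2l//.
  by rewrite lef_pV2 ?posrE; nra.
have dhS i : `|dh i.+1| <= K / ((2 + c) * 2).
  apply: le_trans (lipschitz_inv_shift i.+1 i.+1 c01 d01 hL) _.
  rewrite /K -mulrA ler_wpM2l// opprD addrACA subrr add0r distrC ler_wpM2l//.
  have i0 : (0 : R) <= i%:R by [].
  by rewrite -!natr1 lef_pV2 ?posrE; nra.
rewrite big_ord_recl /= -addrA (le_trans (ler_normD _ _))//.
have -> : 5 / 8 * K = K * (5 / 8) by rewrite mulrC.
apply: (@le_trans _ _ (weight 0 c * (K / (1 + c)) +
                       tail_weight 1 c * (K / ((2 + c) * 2)))).
  apply: lerD.
    by rewrite normrM ger0_norm ?weight_ge0// ler_wpM2l// weight_ge0.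
  have -> : tail_weight 1 c = \sum_(i < n.+1) weight i.+1 c + tail_weight n.+2 c.
    have := sum_weight c (isT : (1 <= n.+2)%N).
    by rewrite big_add1 big_mkord /= => ->; rewrite subrK.
  rewrite mulrDl mulr_suml (le_trans (ler_normD _ _))// lerD//.
    rewrite (le_trans (ler_norm_sum _ _ _))// ler_sum// => i _.
    by rewrite normrM ger0_norm ?weight_ge0// ler_wpM2l// weight_ge0.
  by rewrite normrM ger0_norm ?tail_weight_ge0// ler_wpM2l// tail_weight_ge0.
have -> : weight 0 c * (K / (1 + c)) + tail_weight 1 c * (K / ((2 + c) * 2)) =
    K * ((2 * (2 + c) + (1 + c) ^+ 2) / (2 * (1 + c) * (2 + c) ^+ 2)).
  by rewrite weightE// /tail_weight; field; rewrite !lt0r_neq0//; lra.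
(* The rational function of [c] attains its maximum 5/8 on [0, 1] at [c = 0]. *)
rewrite ler_wpM2l// ler_pdivrMr; first nra.
by rewrite !mulr_gt0 ?exprn_gt0//; lra.
Qed.

(** Second half, already summed by parts: the arguments stay at [d] and the weights move. The tail
    weights supply the factor [c - d], the consecutive arguments of [h] supply the decay in [i]. *)
Lemma shift_part_bound (R : realType) (L : R) (h : R -> R) (c d : R) (n : nat) :
  0 <= L -> 0 <= c <= 1 -> 0 <= d <= 1 -> lipschitz01 L h ->
  `|\sum_(i < n) (tail_weight i.+1 c - tail_weight i.+1 d) *
     (h (i.+2%:R + d)^-1 - h (i.+1%:R + d)^-1)| <= 1 / 4 * (L * `|c - d|).
Proof.
move=> L0 c01 d01 hL; set K := L * _.
have K0 : 0 <= K by rewrite mulr_ge0.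
(* An antidifference of [1 / ((i + 1) (i + 2) (i + 3))]; the bounds telescope to at most
   [- K * f 0 = K / 4]. *)
pose f i : R := - (2 * (i.+1%:R * i.+2%:R))^-1.
apply: (@le_trans _ _ (\sum_(0 <= i < n) K * (f i.+1 - f i))); last first.
  rewrite -mulr_sumr telescope_sumr// mulrC ler_wpM2r// /f.
  have -> : (2 * (1 * 2))^-1 = 1 / 4 :> R by field.
  by rewrite opprK gerDr oppr_le0.
rewrite big_mkord (le_trans (ler_norm_sum _ _ _))// ler_sum// => i _.
rewrite normrM.
have i0 : (0 : R) <= i%:R by [].
have -> : tail_weight i.+1 c - tail_weight i.+1 d =
    (c - d) * ((i%:R + 1) / ((i%:R + 2 + c) * (i%:R + 2 + d))).
  rewrite /tail_weight -!natr1; field; rewrite !lt0r_neq0//; lra.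
rewrite normrM [X in _ * X * _]ger0_norm; last by rewrite divr_ge0 ?mulr_ge0//; lra.
apply: le_trans (_ : _ <= `|c - d| * ((i%:R + 1) / ((i%:R + 2 + c) * (i%:R + 2 + d)))
   * (L * (1 / ((i%:R + 2 + d) * (i%:R + 1 + d))))) _.
  rewrite ler_wpM2l//.
    by rewrite mulr_ge0// divr_ge0 ?mulr_ge0//; lra.
  apply: le_trans (lipschitz_inv_shift i.+1 i d01 d01 hL) _.
  rewrite ler_wpM2l// -!natr1 (_ : _ - _ = -1); last by ring.
  by rewrite normrN1 add0r addrA.
have -> : f i.+1 - f i = ((i%:R + 1) * (i%:R + 2) * (i%:R + 3))^-1.
  by rewrite /f -!natr1; field; rewrite !lt0r_neq0//; lra.
set x := i%:R in i0 *.
have -> : `|c - d| * ((x + 1) / ((x + 2 + c) * (x + 2 + d))) *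
   (L * (1 / ((x + 2 + d) * (x + 1 + d)))) =
   K * (((x + 1) / (x + 1 + d)) * ((x + 2 + c) * (x + 2 + d) ^+ 2)^-1).
  by rewrite /K; field; rewrite !lt0r_neq0//; lra.
rewrite ler_wpM2l//.
apply: le_trans (_ : _ <= 1 * ((x + 2 + c) * (x + 2 + d) ^+ 2)^-1) _.
  rewrite ler_wpM2r ?invr_ge0 ?mulr_ge0 ?exprn_ge0//; try lra.
  by rewrite ler_pdivrMr; lra.
rewrite mul1r lef_pV2 ?posrE ?mulr_gt0 ?exprn_gt0//; try lra.
apply: le_trans (_ : _ <= (x + 2) * (x + 2) ^+ 2) _; first nra.
by rewrite ler_pM ?exprn_ge0//; [lra|lra|lra|nra].
Qed.

(** The two halves give 5/8 + 1/4 = 7/8. The estimate is made on partial sums, where boundary terms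
    of size [tail_weight n c * B] remain; they vanish in the limit. *)
Lemma gauss_op_lipschitz (R : realType) (L : R) (h : R -> R) :
  0 <= L -> bounded01 h -> lipschitz01 L h -> lipschitz01 (7 / 8 * L) (gauss_op h).
Proof.
move=> L0 bh hL c d c01 d01; have [B hB] := bh.
have [c0 d0] : 0 <= c /\ 0 <= d by lra.
pose S e n := \sum_(i < n) weight i e * h (i.+1%:R + e)^-1.
have cS e : 0 <= e <= 1 -> S e n @[n --> \oo] --> gauss_op h e.
  move=> e01; rewrite (_ : S e = series (fun i => weight i e * h (i.+1%:R + e)^-1)).
    exact: gauss_op_cvg.
  by apply/funext => n; rewrite /series /= big_mkord.
have lhs : `|S c n - S d n| @[n --> \oo] --> `|gauss_op h c - gauss_op h d|.
  by apply: cvg_norm; apply: cvgB; exact: cS.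
have rhs : 7 / 8 * L * `|c - d| + (tail_weight n c + tail_weight n d) * B
    @[n --> \oo] --> 7 / 8 * L * `|c - d|.
  rewrite -[X in _ --> X]addr0; apply: cvgD; first exact: cvg_cst.
  rewrite -[X in _ --> X](mul0r B); apply: cvgMr_tmp.
  by rewrite -[X in _ --> X]addr0; apply: cvgD; exact: tail_weight_cvg0.
apply: (ler_cvg_to lhs rhs); near=> m.
have [n ->] : exists n, m = n.+2.
  by exists (m - 2)%N; rewrite -addn2 subnK//; near: m; exact: nbhs_infty_ge.
rewrite /S.
have A := weight_part_bound n L0 c01 d01 hL.
have C := shift_part_bound n.+1 L0 c01 d01 hL.
have := abel_sum (fun i => tail_weight i c - tail_weight i d)
          (fun i => h (i.+1%:R + d)^-1) n.+1.
rewrite !tail_weight0// subrr mul0r add0r.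
set S1 := \sum_(i < n.+2) _ => E.
rewrite -E in C.
have nB e : 0 <= e <= 1 ->
    `|tail_weight n.+2 e * h (n.+2%:R + e)^-1| <= tail_weight n.+2 e * B.
  move=> e01; have e0 : 0 <= e by lra.
  rewrite normrM ger0_norm ?tail_weight_ge0// ler_wpM2l ?tail_weight_ge0//.
  exact/hB/inv_shift01.
set A' := (X in `|X| <= _) in A; set C' := (X in `|X| <= _) in C.
have -> : \sum_(i < n.+2) weight i c * h (i.+1%:R + c)^-1 -
    \sum_(i < n.+2) weight i d * h (i.+1%:R + d)^-1 =
    A' + C' - tail_weight n.+2 c * h (n.+2%:R + c)^-1
     + tail_weight n.+2 d * h (n.+2%:R + d)^-1.
  rewrite /A' /C' /S1.
  have -> : \sum_(i < n.+2) weight i c * (h (i.+1%:R + c)^-1 - h (i.+1%:R + d)^-1) =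
     \sum_(i < n.+2) weight i c * h (i.+1%:R + c)^-1
     - \sum_(i < n.+2) weight i c * h (i.+1%:R + d)^-1.
    by rewrite -sumrB; apply: eq_bigr => i _; rewrite mulrBr.
  have -> : \sum_(i < n.+2) (tail_weight i c - tail_weight i d -
     (tail_weight i.+1 c - tail_weight i.+1 d)) * h (i.+1%:R + d)^-1 =
     \sum_(i < n.+2) weight i c * h (i.+1%:R + d)^-1
     - \sum_(i < n.+2) weight i d * h (i.+1%:R + d)^-1.
    by rewrite -sumrB; apply: eq_bigr => i _; rewrite /weight; ring.
  ring.
have Bc := nB _ c01; have Bd := nB _ d01.
rewrite (le_trans (ler_normD _ _))// (le_trans (lerD (ler_normB _ _) (lexx _)))//.
rewrite (le_trans (lerD (lerD (ler_normD _ _) (lexx _)) (lexx _)))//.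
lra.
Unshelve. all: by end_near. Qed.

(** * Iterates of [U] on Möbius distribution functions *)

Lemma itv_bounded01 (R : realType) (lo hi : R) (h : R -> R) :
  (forall c : R, 0 <= c <= 1 -> lo <= h c <= hi) -> bounded01 h.
Proof.
move=> hI; exists (`|lo| + `|hi|) => c /hI hc.
have := ler_norm hi; have := ler_norm (- lo); have := normr_ge0 lo.
have := normr_ge0 hi; rewrite normrN ler_norml; lra.
Qed.

(** [U] is monotone and fixes constants. *)
Lemma gauss_op_itv (R : realType) (lo hi c : R) (h : R -> R) :
  (forall d : R, 0 <= d <= 1 -> lo <= h d <= hi) -> 0 <= c <= 1 ->
  lo <= gauss_op h c <= hi.
Proof.
move=> hI c01; have bh := itv_bounded01 hI.
have bcst B : bounded01 (fun=> B : R) by exists `|B|.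
rewrite -{1}(gauss_op_cst lo c01) -{1}(gauss_op_cst hi c01).
by apply/andP; split; apply: gauss_op_le => // d /hI/andP[].
Qed.

(* The density (1 + c) / (1 + c t)^2 on [0, 1], c = q_(k-1) / q_k, is that of the
   k-th Gauss iterate of a uniform point conditioned on its first k digits. *)
Definition mobius_cdf (R : realType) (t c : R) : R := (1 + c) * t / (1 + c * t).

Definition gauss_cdf (R : realType) (k : nat) (t : R) : R -> R :=
  iter k (@gauss_op R) (mobius_cdf t).

Lemma gauss_cdf_itv (R : realType) (k : nat) (t lo hi c : R) :
  (forall d : R, 0 <= d <= 1 -> lo <= mobius_cdf t d <= hi) -> 0 <= c <= 1 ->
  lo <= gauss_cdf k t c <= hi.
Proof.
move=> hI; elim: k c => [|k IH] c c01; first exact: hI.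
exact: gauss_op_itv.
Qed.

Lemma mobius_cdf01 (R : realType) (t c : R) :
  0 <= t <= 1 -> 0 <= c <= 1 -> 0 <= mobius_cdf t c <= 1.
Proof.
move=> t01 c01; have p : 0 <= c * t by rewrite mulr_ge0; lra.
by rewrite divr_ge0 ?mulr_ge0 /= ?ler_pdivrMr; lra.
Qed.

Lemma mobius_cdf_le (R : realType) (t c : R) :
  0 <= t <= 1 -> 0 <= c <= 1 -> mobius_cdf t c <= 2 * t.
Proof.
move=> t01 c01; have p : 0 <= c * t by rewrite mulr_ge0; lra.
have p2 : 0 <= c * t * t by rewrite mulr_ge0; lra.
by rewrite ler_pdivrMr; nra.
Qed.

Lemma gauss_cdf01 (R : realType) (k : nat) (t c : R) :
  0 <= t <= 1 -> 0 <= c <= 1 -> 0 <= gauss_cdf k t c <= 1.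
Proof. by move=> t01; apply: gauss_cdf_itv => d; exact: mobius_cdf01. Qed.

Lemma gauss_cdf_le (R : realType) (k : nat) (t c : R) :
  0 <= t <= 1 -> 0 <= c <= 1 -> gauss_cdf k t c <= 2 * t.
Proof.
move=> t01 c01; suff /andP[] : 0 <= gauss_cdf k t c <= 2 * t by [].
apply: gauss_cdf_itv => // d d01; rewrite mobius_cdf_le// andbT.
by case/andP: (mobius_cdf01 t01 d01).
Qed.

Lemma bounded_gauss_cdf (R : realType) (k : nat) (t : R) :
  0 <= t <= 1 -> bounded01 (gauss_cdf k t).
Proof. by move=> t01; apply: itv_bounded01 => c; exact: gauss_cdf01. Qed.

Lemma gauss_cdf_at1 (R : realType) (k : nat) (c : R) :
  0 <= c <= 1 -> gauss_cdf k 1 c = 1.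
Proof.
move=> c01; apply/eqP; rewrite eq_le andbC; apply: gauss_cdf_itv => // d d01.
by rewrite /mobius_cdf !mulr1 divff ?lexx// lt0r_neq0//; lra.
Qed.

Lemma gauss_cdf_at0 (R : realType) (k : nat) (c : R) :
  0 <= c <= 1 -> gauss_cdf k 0 c = 0.
Proof.
move=> c01; apply/eqP; rewrite eq_le andbC; apply: gauss_cdf_itv => // d d01.
by rewrite /mobius_cdf !mulr0 mul0r lexx.
Qed.

Lemma gauss_cdf_lipschitz (R : realType) (k : nat) (t : R) :
  0 <= t <= 1 -> lipschitz01 ((7 / 8) ^+ k) (gauss_cdf k t).
Proof.
move=> t01; elim: k => [|k IH]; last first.
  by rewrite exprS; apply: gauss_op_lipschitz => //; exact: bounded_gauss_cdf.
move=> c d c01 d01; rewrite expr0 mul1r /gauss_cdf /= /mobius_cdf.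
have p : 0 <= c * t by rewrite mulr_ge0; lra.
have q : 0 <= d * t by rewrite mulr_ge0; lra.
(* The second factor lies in [0, 1], so the Lipschitz constant at [k = 0] is 1. *)
have -> : (1 + c) * t / (1 + c * t) - (1 + d) * t / (1 + d * t) =
    (c - d) * (t * (1 - t) / ((1 + c * t) * (1 + d * t))).
  by field; rewrite !lt0r_neq0//; lra.
rewrite normrM ler_piMr// ger0_norm; last by rewrite !mulr_ge0 ?invr_ge0 ?mulr_ge0//; lra.
rewrite ler_pdivrMr ?mulr_gt0//; try lra.
apply: le_trans (_ : _ <= 1) _; first nra.
by rewrite mul1r; nra.
Qed.

(** For a distribution function [F], the mass of the points whose first digit is at most [M] and
    whose Gauss image is below [t]: the digit [a] contributes the interval from [1 / (a + t)] to
    [1 / a]. *)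
Definition gauss_sum (R : realType) (F : R -> R) (t : R) (M : nat) : R :=
  \sum_(a < M) (F a.+1%:R^-1 - F (a.+1%:R + t)^-1).

(** [gauss_op] acts on [c] and [gauss_sum] on [t]. For [mobius_cdf] they agree term by term up to
    truncation; since [gauss_op] is linear and monotone, it carries the inequalities from [k] to
    [k + 1]. The error is the mass of the digits above [M]. *)
Lemma gauss_cdf_step (R : realType) (k M : nat) (t c : R) :
  0 <= t <= 1 -> 0 <= c <= 1 ->
  gauss_sum (fun u => gauss_cdf k u c) t M <= gauss_cdf k.+1 t c
  <= gauss_sum (fun u => gauss_cdf k u c) t M + gauss_cdf k M.+1%:R^-1 c.
Proof.
move=> t01; have t0 : 0 <= t by lra.
have i01 a := inv_nat01 R (ltn0Sn a).
elim: k c => [|k IH] c c01; last first.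
  have bd a : bounded01
      (fun d => gauss_cdf k a.+1%:R^-1 d - gauss_cdf k (a.+1%:R + t)^-1 d).
    by apply: bounded01B; apply: bounded_gauss_cdf; rewrite ?inv_shift01.
  have bS := bounded01_sum M bd.
  have bM := bounded_gauss_cdf k (i01 M).
  have -> : gauss_sum (fun u => gauss_cdf k.+1 u c) t M =
     gauss_op (fun d => gauss_sum (fun u => gauss_cdf k u d) t M) c.
    rewrite (gauss_op_sum M bd c01); apply: eq_bigr => a _.
    by rewrite gauss_opB//; apply: bounded_gauss_cdf; rewrite ?inv_shift01.
  have -> : gauss_cdf k.+2 t c = gauss_op (gauss_cdf k.+1 t) c by [].
  have -> : gauss_cdf k.+1 M.+1%:R^-1 c = gauss_op (gauss_cdf k M.+1%:R^-1) c by [].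
  have bt := bounded_gauss_cdf k.+1 t01.
  rewrite -gauss_opD//; apply/andP; split.
    by apply: gauss_op_le => // d /IH /andP[].
  by apply: gauss_op_le => //; [exact: bounded01D | move=> d /IH /andP[]].
have c0 : 0 <= c by lra.
(* Given the digit [a + 1], the law keeps its Möbius form with the new parameter
   [1 / (a + 1 + c)]. *)
have E a : gauss_cdf 0 a.+1%:R^-1 c - gauss_cdf 0 (a.+1%:R + t)^-1 c =
    weight a c * mobius_cdf t (a.+1%:R + c)^-1.
  rewrite weightE// /gauss_cdf /= /mobius_cdf.
  have a0 : (0 : R) <= a%:R by [].
  by rewrite -!natr1; field; rewrite !lt0r_neq0//; lra.
have w0 a : 0 <= weight a c * mobius_cdf t (a.+1%:R + c)^-1 <= weight a c.
  have /andP[m0 m1] := mobius_cdf01 t01 (inv_shift01 a c0).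
  by rewrite mulr_ge0 ?weight_ge0//= ler_piMr// weight_ge0.
have cv := @gauss_op_cvg _ (mobius_cdf t) c (bounded_gauss_cdf 0 t01) c01.
have tM : gauss_cdf 0 M.+1%:R^-1 c = tail_weight M c.
  rewrite /gauss_cdf /= /mobius_cdf /tail_weight.
  have a0 : (0 : R) <= M%:R by [].
  by rewrite -!natr1; field; rewrite !lt0r_neq0//; lra.
rewrite /gauss_sum; under eq_bigr do rewrite E.
rewrite tM; apply/andP; split.
  apply: (cvgr_to_ge cv); near=> n.
  have Mn : (M <= n)%N by near: n; exact: nbhs_infty_ge.
  rewrite /series /= (big_cat_nat (leq0n M) Mn)/= big_mkord lerDl sumr_ge0// => i _.
  by case/andP: (w0 i).
apply: (cvgr_to_le cv); near=> n.
have Mn : (M <= n)%N by near: n; exact: nbhs_infty_ge.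
rewrite /series /= (big_cat_nat (leq0n M) Mn)/= big_mkord lerD2l.
apply: le_trans (_ : _ <= \sum_(M <= i < n) weight i c) _.
  by apply: ler_sum => i _; case/andP: (w0 i).
by rewrite sum_weight// gerBl tail_weight_ge0.
Unshelve. all: by end_near. Qed.

(** * Comparison with the Gauss law *)

(** [F'] is the law of the Gauss image of a point with law [F]. Arbitrary functions are allowed so
    that differences of laws are covered. *)
Definition gauss_step (R : realType) (F F' : R -> R) : Prop :=
  forall t, 0 <= t <= 1 -> gauss_sum F t M @[M --> \oo] --> F' t.

Definition nondecreasing01 (R : realType) (F : R -> R) : Prop :=
  forall s t, 0 <= s -> s <= t -> t <= 1 -> F s <= F t.

(** The interval from [1 / (a + t)] to [1 / a] grows with [t]. Applied to a difference of laws, this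
    says that the Gauss map preserves the order of measures. *)
Lemma gauss_step_nondecreasing (R : realType) (F F' : R -> R) :
  gauss_step F F' -> nondecreasing01 F -> nondecreasing01 F'.
Proof.
move=> st nd s t s0 st' t1.
have s01 : 0 <= s <= 1 by lra.
have t01 : 0 <= t <= 1 by lra.
apply: (ler_cvg_to (st _ s01) (st _ t01)); near=> M.
apply: ler_sum => a _; rewrite lerD2l lerN2.
have /andP[] := inv_shift01 a s0; have /andP[] := inv_shift01 a (le_trans s0 st').
move=> h1 h2 h3 h4; apply: nd => //.
by rewrite lef_pV2 ?posrE ?lerD2l// ltr_wpDr//; lra.
Unshelve. all: by end_near. Qed.

Lemma gauss_stepB (R : realType) (F F' G G' : R -> R) :
  gauss_step F F' -> gauss_step G G' ->
  gauss_step (fun t => F t - G t) (fun t => F' t - G' t).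
Proof.
move=> sF sG t t01.
rewrite (_ : gauss_sum _ t = fun M => gauss_sum F t M - gauss_sum G t M).
  by apply: cvgB; [exact: sF | exact: sG].
by apply/funext => M; rewrite -sumrB; apply: eq_bigr => a _; ring.
Qed.

Lemma gauss_stepZ (R : realType) (k : R) (F F' : R -> R) :
  gauss_step F F' -> gauss_step (fun t => k * F t) (fun t => k * F' t).
Proof.
move=> sF t t01; rewrite (_ : gauss_sum _ t = fun M => k * gauss_sum F t M).
  by apply: cvgMl_tmp; exact: sF.
by apply/funext => M; rewrite mulr_sumr; apply: eq_bigr => a _; ring.
Qed.

Lemma cvg_sum_ord (R : realType) (M : nat) (f : nat -> nat -> R) (l : nat -> R) :
  (forall a, (a < M)%N -> f a N @[N --> \oo] --> l a) ->
  \sum_(a < M) f a N @[N --> \oo] --> \sum_(a < M) l a.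
Proof.
elim: M => [|M IH] fl.
  by rewrite big_ord0; under eq_fun do rewrite big_ord0; exact: cvg_cst.
rewrite big_ord_recr; under eq_fun do rewrite big_ord_recr /=.
by apply: cvgD; [apply: IH => a aM; apply: fl; rewrite ltnW | exact: fl].
Qed.

Lemma gauss_step_sum (R : realType) (m : nat) (F F' : nat -> R -> R) :
  (forall j, (j < m)%N -> gauss_step (F j) (F' j)) ->
  gauss_step (fun t => \sum_(j < m) F j t) (fun t => \sum_(j < m) F' j t).
Proof.
move=> sF t t01.
rewrite (_ : gauss_sum _ t = fun M => \sum_(j < m) gauss_sum (F j) t M).
  apply: (@cvg_sum_ord R m (fun j M => gauss_sum (F j) t M) (F'^~ t)) => j jm.
  exact: sF.
apply/funext => M; rewrite exchange_big; apply: eq_bigr => a _.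
by rewrite -sumrB.
Qed.

Lemma gauss_cdf_gauss_step (R : realType) (k : nat) (c : R) : 0 <= c <= 1 ->
  gauss_step (fun t => gauss_cdf k t c) (fun t => gauss_cdf k.+1 t c).
Proof.
move=> c01 t t01.
apply: (@squeeze_cvgr _ _ _ _ (fun M => gauss_cdf k.+1 t c - 2 * harmonic M)
                              (fun=> gauss_cdf k.+1 t c)).
- near=> M; have := gauss_cdf_step k M t01 c01.
  have i01 := inv_nat01 R (ltn0Sn M).
  have := gauss_cdf_le k i01 c01; rewrite /harmonic /=.
  by move: (M.+1%:R^-1) (gauss_cdf k _ _) (gauss_sum _ _ _) => u x S; lra.
- rewrite -[X in _ --> X]subr0 -[X in _ - X](mulr0 2).
  by apply: cvgB; [exact: cvg_cst | apply: cvgMl_tmp; exact: cvg_harmonic].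
- exact: cvg_cst.
Unshelve. all: by end_near. Qed.

Lemma gauss_sumS (R : realType) (F : R -> R) (t : R) (M : nat) :
  gauss_sum F t M.+1 = gauss_sum F t M + (F M.+1%:R^-1 - F (M.+1%:R + t)^-1).
Proof. exact: big_ord_recr. Qed.

(** Telescoping, by [(1 + 1/a) / (1 + 1/(a + t)) = (1 + t/a) / (1 + t/(a + 1))]. *)
Lemma ln_gauss_sum (R : realType) (t : R) (M : nat) : 0 <= t ->
  gauss_sum (fun u => ln (1 + u)) t M = ln (1 + t) - ln (1 + t / M.+1%:R).
Proof.
move=> t0; elim: M => [|M IH]; first by rewrite /gauss_sum big_ord0 divr1 subrr.
rewrite gauss_sumS IH.
have M0 : (0 : R) <= M%:R by [].
have p (u : R) : 0 < u -> u \is Num.pos by rewrite posrE.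
have q : 0 <= t / (M%:R + 1) by rewrite divr_ge0//; lra.
have q' : 0 <= t / (M%:R + 1 + 1) by rewrite divr_ge0//; lra.
have r : 0 < (M%:R + 1 : R)^-1 by rewrite invr_gt0; lra.
have r' : 0 < (M%:R + 1 + t : R)^-1 by rewrite invr_gt0; lra.
rewrite -!natr1.
suff : ln (1 + (M%:R + 1)^-1) + ln (1 + t / (M%:R + 1 + 1)) =
       ln (1 + t / (M%:R + 1)) + ln (1 + (M%:R + 1 + t)^-1) by lra.
rewrite -!lnM; try (apply: p; lra).
by congr ln; field; rewrite !lt0r_neq0//; lra.
Qed.

(** Invariance of the Gauss measure, before normalisation by [ln 2]. *)
Lemma ln_gauss_step (R : realType) :
  gauss_step (fun t : R => ln (1 + t)) (fun t => ln (1 + t)).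
Proof.
move=> t t01; have t0 : 0 <= t by lra.
under eq_fun do rewrite ln_gauss_sum//.
apply: (@squeeze_cvgr _ _ _ _ (fun M => ln (1 + t) - harmonic M)
                              (fun=> ln (1 + t))).
- near=> M.
  have h0 : 0 < (M.+1%:R^-1 : R) by rewrite invr_gt0.
  have tM : 0 <= t / M.+1%:R by rewrite divr_ge0//; lra.
  have tM' : t / M.+1%:R <= M.+1%:R^-1 by rewrite ler_piMl//; lra.
  have l0 : 0 <= ln (1 + t / M.+1%:R) by rewrite ln_ge0// lerDl.
  have l1 : ln (1 + t / M.+1%:R) <= t / M.+1%:R.
    by rewrite le_ln1Dx// (lt_le_trans _ tM)// ltrN10.
  rewrite /harmonic /=; move: (M.+1%:R^-1) (t / _) (ln (1 + t / _)) tM tM' l0 l1.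
  by move=> x y z; lra.
- by rewrite -[X in _ --> X]subr0;
    apply: cvgB; [exact: cvg_cst | exact: cvg_harmonic].
- exact: cvg_cst.
Unshelve. all: by end_near. Qed.

(* A Riemann sum for ln (1 + t) = int_0^1 (mobius_cdf t c) / (1 + c) dc, with the
   grid points c = j / m. *)
Definition log_mixture (R : realType) (m k : nat) (t : R) : R :=
  \sum_(j < m) (m + j)%:R^-1 * gauss_cdf k t (j%:R / m%:R).

Lemma grid01 (R : realType) (m j : nat) : (j < m)%N -> 0 <= (j%:R / m%:R : R) <= 1.
Proof.
move=> jm; have m0 : (0 : R) < m%:R by rewrite ltr0n (leq_ltn_trans _ jm).
by rewrite divr_ge0//= ler_pdivrMr// mul1r ler_nat ltnW.
Qed.

Lemma log_mixture_step (R : realType) (m k : nat) :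
  gauss_step (@log_mixture R m k) (log_mixture m k.+1).
Proof.
apply: (gauss_step_sum
  (F := fun j t => (m + j)%:R^-1 * gauss_cdf k t (j%:R / m%:R))
  (F' := fun j t => (m + j)%:R^-1 * gauss_cdf k.+1 t (j%:R / m%:R))) => j jm.
apply: (gauss_stepZ (F := fun t => gauss_cdf k t (j%:R / m%:R))
                    (F' := fun t => gauss_cdf k.+1 t (j%:R / m%:R))).
exact/gauss_cdf_gauss_step/grid01.
Qed.

(** Increments are compared instead of values, because monotonicity of a difference is what a Gauss
    step preserves. *)
Lemma log_mixture_incr (R : realType) (m : nat) (s t : R) :
  (0 < m)%N -> 0 <= s -> s <= t -> t <= 1 ->
  (1 - m%:R^-1) * (log_mixture m 0 t - log_mixture m 0 s) <= ln (1 + t) - ln (1 + s)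
  <= log_mixture m 0 t - log_mixture m 0 s.
Proof.
move=> m_gt0 s0 st t1; have m0 : (1 : R) <= m%:R by rewrite ler1n.
set x : R := m%:R in m0 *.
(* For real [j], [I j] is the derivative of [L], and it decreases: the sum of the [I j] is a left
   Riemann sum, while the increments of [L] telescope. *)
pose L j := ln (x + j%:R * t) - ln (x + j%:R * s).
pose I j : R := x * (t - s) / ((x + j%:R * t) * (x + j%:R * s)).
have -> : ln (1 + t) - ln (1 + s) = \sum_(0 <= j < m) (L j.+1 - L j).
  rewrite telescope_sumr// /L !mul0r addr0 subrr subr0 -/x.
  have E u : x + x * u = x * (1 + u) by ring.
  by rewrite !E !lnM ?posrE; lra.
have -> : log_mixture m 0 t - log_mixture m 0 s = \sum_(0 <= j < m) I j.
  rewrite big_mkord -sumrB; apply: eq_bigr => j _.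
  have j0 : (0 : R) <= j%:R by [].
  have jt : 0 <= j%:R * t by rewrite mulr_ge0//; lra.
  have js : 0 <= j%:R * s by rewrite mulr_ge0//; lra.
  rewrite /gauss_cdf /= /mobius_cdf natrD -/x /I.
  by field; rewrite !lt0r_neq0//; lra.
have LI j : (1 - x^-1) * I j <= L j.+1 - L j <= I j.
  have j0 : (0 : R) <= j%:R by [].
  have jt : 0 <= j%:R * t by rewrite mulr_ge0//; lra.
  have js : 0 <= j%:R * s by rewrite mulr_ge0//; lra.
  have E u : x + j.+1%:R * u = x + j%:R * u + u by rewrite -natr1; ring.
  rewrite /L /I !E.
  set a : R := x + j%:R * t; set b : R := x + j%:R * s.
  have a0 : x <= a by rewrite /a; lra.
  have b0 : x <= b by rewrite /b; lra.
  have ab : t * b - s * a = x * (t - s) by rewrite /a /b; ring.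
  have p (u : R) : 0 < u -> u \is Num.pos by rewrite posrE.
  have y0 : 0 <= x * (t - s) by rewrite mulr_ge0; lra.
  have y1 : 0 <= x * (t - s) / ((b + s) * a) by rewrite divr_ge0 ?mulr_ge0; lra.
  have y2 : 0 <= x * (t - s) / (a * b) by rewrite divr_ge0 ?mulr_ge0; lra.
  (* Upper bound: [ln (1 + y) <= y], then [(b + s) * a >= a * b]. *)
  apply/andP; split; last first.
    have -> : ln (a + t) - ln (b + s) - (ln a - ln b) =
        ln (1 + x * (t - s) / ((b + s) * a)).
      have -> : 1 + x * (t - s) / ((b + s) * a) = (a + t) * b / ((b + s) * a).
        by rewrite -ab; field; rewrite !lt0r_neq0//; lra.
      rewrite ln_div ?posrE ?mulr_gt0//; try lra.
      by rewrite !lnM; try (apply: p; lra); lra.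
    apply: le_trans (_ : _ <= x * (t - s) / ((b + s) * a)) _.
      by rewrite le_ln1Dx//; lra.
    rewrite ler_wpM2l// lef_pV2 ?posrE ?mulr_gt0//; try lra.
    have : 0 <= s * a by rewrite mulr_ge0; lra.
    lra.
  (* Lower bound: [ln (1 - y) <= - y]; the factor [a / (a + t)] is at least [1 - 1/x] because
     [a >= x] and [t <= 1]. *)
  have -> : ln (a + t) - ln (b + s) - (ln a - ln b) =
      - ln (1 + - (x * (t - s) / ((a + t) * b))).
    have -> : 1 + - (x * (t - s) / ((a + t) * b)) = (b + s) * a / ((a + t) * b).
      by rewrite -ab; field; rewrite !lt0r_neq0//; lra.
    rewrite ln_div ?posrE ?mulr_gt0//; try lra.
    by rewrite !lnM; try (apply: p; lra); lra.
  rewrite lerNr.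
  apply: le_trans (_ : _ <= - (x * (t - s) / ((a + t) * b))) _.
    rewrite le_ln1Dx// ltrN2 ltr_pdivrMr ?mulr_gt0//; try lra.
    by rewrite -ab mul1r; nra.
  rewrite lerN2 (_ : x * (t - s) / ((a + t) * b) = a / (a + t) * (x * (t - s) / (a * b))).
    rewrite ler_wpM2r// ler_pdivlMr; last lra.
    have -> : (1 - x^-1) * (a + t) = a + t - (a + t) / x.
      by field; rewrite lt0r_neq0//; lra.
    have : t <= (a + t) / x by rewrite ler_pdivlMr; nra.
    lra.
  by field; rewrite !lt0r_neq0//; lra.
by rewrite mulr_sumr; apply/andP; split; apply: ler_sum => j _; case/andP: (LI j).
Qed.

(** Pointwise inequalities need not survive a Gauss step, whose terms are differences. The induction
    therefore carries monotonicity of two differences, and both vanish at [t = 0]. *)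
Lemma log_mixture_bounds (R : realType) (m k : nat) (t : R) :
  (0 < m)%N -> 0 <= t <= 1 ->
  (1 - m%:R^-1) * log_mixture m k t <= ln (1 + t) <= log_mixture m k t.
Proof.
move=> m0 t01.
have nd1 : nondecreasing01 (fun t => log_mixture m k t - ln (1 + t) : R).
  elim: k => [|k IH].
    by move=> u v u0 uv v1; have := log_mixture_incr m0 u0 uv v1; lra.
  have st := gauss_stepB (@log_mixture_step R m k) (@ln_gauss_step R).
  exact: gauss_step_nondecreasing st IH.
have nd2 : nondecreasing01 (fun t => ln (1 + t) - (1 - m%:R^-1) * log_mixture m k t : R).
  elim: k {nd1} => [|k IH].
    by move=> u v u0 uv v1; have := log_mixture_incr m0 u0 uv v1; lra.
  have st := gauss_stepZ (k := 1 - m%:R^-1) (@log_mixture_step R m k).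
  exact: gauss_step_nondecreasing (gauss_stepB (@ln_gauss_step R) st) IH.
have z : log_mixture m k 0 = 0 :> R.
  by rewrite /log_mixture big1// => j _; rewrite gauss_cdf_at0 ?mulr0// grid01.
have /andP[t0 t1] := t01.
have := nd1 _ _ (lexx 0) t0 t1; have := nd2 _ _ (lexx 0) t0 t1.
by rewrite z addr0 ln1; lra.
Qed.

Lemma le_of_harmonic (R : realType) (x y : R) :
  (forall m, (1 - m.+1%:R^-1) * x <= y) -> x <= y.
Proof.
move=> xy; have cv : (1 - harmonic m) * x @[m --> \oo] --> (1 - 0) * x.
  by apply: cvgMr_tmp; apply: cvgB; [exact: cvg_cst | exact: cvg_harmonic].
rewrite -[x]mul1r -[1]subr0; apply: (cvgr_to_le cv).
by near=> m; exact: xy.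
Unshelve. all: by end_near. Qed.

(** All values averaged in the mixture are within [(7/8)^k] of the one at [c = 0]. Hence [F] times
    the total mass [W] is close to [ln (1 + t)], where [W] tends to [ln 2] as the grid is
    refined. *)
Lemma gauss_kuzmin (R : realType) (k : nat) (t : R) : 0 <= t <= 1 ->
  `|gauss_cdf k t 0 - ln (1 + t) / ln 2| <= (7 / 8) ^+ k.
Proof.
move=> t01; have ln2 : 0 < ln 2 :> R by rewrite ln_gt0// ltr1n.
set F := gauss_cdf k t 0; set q := (7 / 8) ^+ k.
have key m : (1 - m.+1%:R^-1) * (F * ln 2) <= ln (1 + t) + q * ln 2 /\
             (1 - m.+1%:R^-1) * ln (1 + t) <= F * ln 2 + q * ln 2.
  have i01 := inv_nat01 R (ltn0Sn m).
  set y := 1 - _; have y0 : 0 <= y <= 1 by rewrite /y subr_ge0 gerBl andbC.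
  have o01 : 0 <= (1 : R) <= 1 by lra.
  have z01 : 0 <= (0 : R) <= 1 by lra.
  have := log_mixture_bounds k (isT : (0 < m.+1)%N) t01.
  (* At [t = 1] the mixture equals its total mass, so this compares [W] with [ln 2]. *)
  have := log_mixture_bounds k (isT : (0 < m.+1)%N) o01.
  rewrite -/y.
  pose W : R := \sum_(j < m.+1) (m.+1 + j)%:R^-1.
  have -> : log_mixture m.+1 k 1 = W.
    by apply: eq_bigr => j _; rewrite gauss_cdf_at1 ?mulr1// grid01.
  have dist : `|F * W - log_mixture m.+1 k t| <= q * W.
    rewrite /log_mixture /W !mulr_sumr -sumrB (le_trans (ler_norm_sum _ _ _))//.
    apply: ler_sum => j _; rewrite [F * _]mulrC -mulrBr normrM mulrC.
    rewrite [`|_^-1|]ger0_norm ?invr_ge0// ler_wpM2r ?invr_ge0//.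
    apply: le_trans (gauss_cdf_lipschitz k t01 z01 (grid01 R (ltn_ord j))) _.
    rewrite ler_piMr ?exprn_ge0// sub0r normrN.
    by have /andP[] := grid01 R (ltn_ord j); move=> g0 g1; rewrite ger0_norm.
  have /andP[F0 F1] : 0 <= F <= 1 by exact: gauss_cdf01.
  have q0 : 0 <= q by rewrite exprn_ge0.
  move: dist; rewrite ler_norml; set X := log_mixture _ _ _.
  have -> : (1 + 1 = 2 :> R) by [].
  move=> /andP[d1 d2] /andP[w1 w2] /andP[x1 x2].
  have FW : F * ln 2 <= F * W by rewrite ler_wpM2l.
  have qW : q * (y * W) <= q * ln 2 by rewrite ler_wpM2l.
  have FW' : F * (y * W) <= F * ln 2 by rewrite ler_wpM2l.
  have yd1 : y * (F * W - X) <= y * (q * W) by rewrite ler_wpM2l//; lra.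
  have yd2 : y * (X - F * W) <= y * (q * W) by rewrite ler_wpM2l//; lra.
  have yF : y * (F * ln 2) <= y * (F * W) by rewrite ler_wpM2l//; lra.
  have yl : y * ln (1 + t) <= y * X by rewrite ler_wpM2l//; lra.
  by split; nra.
have u1 := le_of_harmonic (fun m => (key m).1).
have u2 := le_of_harmonic (fun m => (key m).2).
rewrite (_ : F - _ = (F * ln 2 - ln (1 + t)) / ln 2); last first.
  by field; rewrite lt0r_neq0.
rewrite normf_div [X in _ / X]gtr0_norm// ler_pdivrMr// ler_norml; lra.
Qed.

(** * Frequencies of complete quotients *)

(** Strict and non-strict bounds are both needed, since a Gauss step exchanges them. A terminated
    expansion counts as not below [t]. *)
Definition frac_below (R : realType) (b : bool) (t : R) (o : option R) : bool :=
  if o is Some y then y - (Num.floor y)%:~R < t ?<= if b else false.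

Lemma frac_part_itv (R : realType) (y : R) : 0 <= y - (Num.floor y)%:~R < 1.
Proof.
by rewrite subr_ge0 floor_le /= ltrBlDl -intrD1 floorD1_gt.
Qed.

Lemma lteif_inv (R : realType) (b : bool) (f w : R) :
  0 < f -> 0 < w -> (f < w^-1 ?<= if b) = (w < f^-1 ?<= if b).
Proof.
move=> f0 w0; case: b => /=.
  by rewrite -[in RHS]lef_pV2 ?posrE ?invr_gt0// invrK.
by rewrite -[in RHS]ltf_pV2 ?posrE ?invr_gt0// invrK.
Qed.

Lemma next_quotient_frac0 (R : realType) (y : R) :
  y - (Num.floor y)%:~R = 0 -> next_quotient y = None.
Proof. by move/eqP; rewrite subr_eq0 /next_quotient => ->. Qed.

Lemma next_quotient_frac (R : realType) (y : R) :
  0 < y - (Num.floor y)%:~R ->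
  next_quotient y = Some (y - (Num.floor y)%:~R)^-1.
Proof.
move=> f0; rewrite /next_quotient ifF//; apply/negbTE.
by rewrite -subr_eq0 lt0r_neq0.
Qed.

(** The next digit is [A] exactly when the fractional part lies in [(1/(A + 1), 1/A]]. At an integer
    the expansion stops; both indicators are then 1 and cancel. *)
Lemma digit_event (R : realType) (A : nat) (o : option R) : (0 < A)%N ->
  (omap Num.floor (obind (@next_quotient R) o) == Some A%:Z)%:R =
  (frac_below true A%:R^-1 o)%:R - (frac_below true A.+1%:R^-1 o)%:R :> R.
Proof.
move=> A0; case: o => [y|] /=; last by rewrite subrr.
have /andP[] := frac_part_itv y; rewrite le_eqVlt => /orP[/eqP f0 _|f0 f1].
  by rewrite next_quotient_frac0// -f0 !invr_ge0 !ler0n subrr.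
rewrite next_quotient_frac//=; set z := (y - _)^-1.
rewrite -[in RHS]/(_ < _ ?<= if true) -[in X in _ - X]/(_ < _ ?<= if true).
rewrite !(lteif_inv _ f0) ?ltr0n//= -/z.
rewrite (_ : (Some _ == Some _) = (Num.floor z == A%:Z))// floor_eq intrD1.
rewrite -[(A%:Z)%:~R]/(A%:R) natr1.
case: (lerP A%:R z) => Az; case: (lerP A.+1%:R z) => Az1 /=; rewrite ?subrr ?subr0//.
by have := le_lt_trans Az1 Az; rewrite ltr_nat ltnNge leqnSn.
Qed.

(** The Gauss step for a single point. Inversion turns [<= t] into the complement of a strict bound,
    hence [~~ b]. For [b] true and [t = 1] neighbouring digit intervals would share an endpoint,
    which [b -> t < 1] excludes. *)
Lemma frac_below_step (R : realType) (b : bool) (t : R) (M : nat) (o : option R) :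
  0 <= t <= 1 -> (b -> t < 1) ->
  let S := \sum_(a < M) ((frac_below true a.+1%:R^-1 o)%:R
                         - (frac_below (~~ b) (a.+1%:R + t)^-1 o)%:R) in
  S <= (frac_below b t (obind (@next_quotient R) o))%:R :> R /\
  (frac_below b t (obind (@next_quotient R) o))%:R
    <= S + (frac_below true M.+1%:R^-1 o)%:R.
Proof.
move=> t01 bt1 /=; case: o => [y|] /=; last first.
  by under eq_bigr do rewrite subrr; rewrite sumr_const mul0rn addr0.
have /andP[] := frac_part_itv y; rewrite le_eqVlt => /orP[/eqP f0 _|f0 f1].
  rewrite next_quotient_frac0//= -f0 big1; first by rewrite add0r.
  move=> a _; rewrite invr_ge0 ler0n lteifS ?subrr//.
  by rewrite invr_gt0 ltr_wpDr//; lra.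
rewrite next_quotient_frac//=; set z := (y - _)^-1.
have z1 : 1 < z by rewrite /z invf_gt1.
have [n nE] : exists n : nat, Num.floor z = n.+1%:Z.
  have : 0 < Num.floor z by rewrite floor_gt0 ltW.
  by case: (Num.floor z) => [[|n]|]// _; exists n.
have := floor_itv z; rewrite intrD1 nE -[(n.+1%:Z)%:~R]/(n.+1%:R).
set E := (z - _ < t ?<= if b) => /andP[nz zn].
have term (a : nat) : (y - (Num.floor y)%:~R <= a.+1%:R^-1)%R%:R
    - (y - (Num.floor y)%:~R < (a.+1%:R + t)^-1 ?<= if ~~ b)%R%:R
    = ((n == a) && E)%:R :> R.
  rewrite -[y - _ <= _]/(y - (Num.floor y)%:~R < a.+1%:R^-1 ?<= if true).
  rewrite !(lteif_inv _ f0)// ?ltr_wpDr//; try lra.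
  rewrite -/z /= [in X in _ - X]lteifNE.
  case: (ltngtP n a) => [na|an|<-] /=.
  - have h : z < a.+1%:R by rewrite (lt_le_trans zn)// natr1 ler_nat.
    rewrite leNgt h /= (_ : (z < _ ?<= if b) = true) ?subrr//.
    by rewrite lteifS// (lt_le_trans h)//; lra.
  - have h : a.+1%:R + 1 <= z by rewrite (le_trans _ nz)// natr1 ler_nat.
    rewrite (_ : a.+1%:R <= z); last by lra.
    rewrite (_ : (z < _ ?<= if b) = false) ?subrr//.
    by case: (b) bt1 => /= [/(_ isT) t1|_]; apply/negbTE; rewrite -?ltNge -?leNgt; lra.
  - rewrite nz /E (_ : (z - _ < t ?<= if b) = (z < n.+1%:R + t ?<= if b)).
      by case: (z < _ ?<= if b); rewrite /= ?subrr ?subr0.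
    by rewrite lteifBlDl.
under eq_bigr do rewrite term.
have -> : \sum_(a < M) ((n == a) && E)%:R = ((n < M)%N && E)%:R :> R.
  elim: M => [|M IH]; first by rewrite big_ord0 ltn0.
  rewrite big_ord_recr /= IH ltnS.
  by case: (ltngtP n M) => //= _; rewrite ?addr0 ?add0r.
(* If the digit [n + 1] exceeds [M], the sum misses it, but the fractional part is then at most
   [1 / (M + 1)] and the extra term compensates. *)
case: (ltnP n M) => nM /=; first by split; rewrite ?lerDl// ler0n.
split; first by rewrite ler0n.
rewrite add0r (_ : y - _ <= _); first by rewrite ler_nat leq_b1.
rewrite -[_ <= _]/(y - (Num.floor y)%:~R < M.+1%:R^-1 ?<= if true) (lteif_inv _ f0)//=.
by rewrite (le_trans _ nz)// ler_nat.
Qed.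

(** An exchange of limits: [M] is fixed with [tau M] small before [N] grows. *)
Lemma squeeze_family (R : realType) (u : nat -> R) (l : R) (S T : nat -> nat -> R)
    (s tau : nat -> R) :
  (forall M N, S M N <= u N <= S M N + T M N) ->
  (forall M, S M N @[N --> \oo] --> s M) ->
  (forall M, T M N @[N --> \oo] --> tau M) ->
  (forall M, s M <= l <= s M + tau M) ->
  tau M @[M --> \oo] --> 0 -> u N @[N --> \oo] --> l.
Proof.
move=> uS cS cT sl ct; apply/cvgrPdist_le => e e0.
have e3 : 0 < e / 3 by lra.
have [M0 _ HM] := (cvgrPdist_le _ _).1 ct _ e3.
have {}HM := HM M0 (leqnn M0); rewrite sub0r normrN in HM.
near=> N.
have h1 : `|s M0 - S M0 N| <= e / 3.
  by near: N; apply: (cvgrPdist_le _ _).1 (cS M0) _ e3.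
have h2 : `|tau M0 - T M0 N| <= e / 3.
  by near: N; apply: (cvgrPdist_le _ _).1 (cT M0) _ e3.
have := uS M0 N; have := sl M0; move: HM h1 h2; rewrite !ler_norml; lra.
Unshelve. all: by end_near. Qed.

Definition empirical (R : realType) (x : nat -> R) (k : nat) (b : bool) (t : R)
    (N : nat) : R :=
  (\sum_(q < N) (frac_below b t (complete_quotient (x q) k))%:R) / N%:R.

(** The induction keeps [b] and [t] general, because a step evaluates frequencies at [1/a] and
    [1/(a + t)] with both kinds of bound. *)
Lemma empirical_cvg (R : realType) (x : nat -> R) :
  (forall b t, 0 <= t <= 1 -> empirical x 0 b t N @[N --> \oo] --> t) ->
  forall k b t, 0 <= t <= 1 ->
  empirical x k b t N @[N --> \oo] --> gauss_cdf k t 0.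
Proof.
move=> equi; elim=> [|k IH] b t t01.
  rewrite (_ : gauss_cdf 0 t 0 = t); first exact: equi.
  by rewrite /gauss_cdf /= /mobius_cdf mul0r !addr0 mul1r divr1.
(* Fractional parts are below 1, so at [t = 1] the strict bound gives the same frequency. *)
wlog bt : b / (b -> t < 1).
  move=> H; case: (ltP t 1) => [t1|t1]; first exact: H.
  have -> : empirical x k.+1 b t = empirical x k.+1 false t; last exact: H.
  apply/funext => N; congr (_ / _); apply: eq_bigr => q _; congr (nat_of_bool _)%:R.
  rewrite /frac_below; case: complete_quotient => // y.
  have /andP[_ f1] := frac_part_itv y.
  by rewrite !lteifS// (lt_le_trans f1).
have t0 : 0 <= t by lra.
have i01 a := inv_nat01 R (ltn0Sn a).
have z01 : 0 <= (0 : R) <= 1 by lra.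
apply: (@squeeze_family R _ _
  (fun M N => \sum_(a < M) (empirical x k true a.+1%:R^-1 N
                           - empirical x k (~~ b) (a.+1%:R + t)^-1 N))
  (fun M N => empirical x k true M.+1%:R^-1 N)
  (fun M => gauss_sum (fun u => gauss_cdf k u 0) t M)
  (fun M => gauss_cdf k M.+1%:R^-1 0)).
- move=> M N; rewrite /empirical.
  have -> : \sum_(a < M) ((\sum_(q < N)
       (frac_below true a.+1%:R^-1 (complete_quotient (x q) k))%:R) / N%:R -
     (\sum_(q < N) (frac_below (~~ b) (a.+1%:R + t)^-1
        (complete_quotient (x q) k))%:R) / N%:R) =
     (\sum_(q < N) \sum_(a < M)
       ((frac_below true a.+1%:R^-1 (complete_quotient (x q) k))%:R
        - (frac_below (~~ b) (a.+1%:R + t)^-1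
             (complete_quotient (x q) k))%:R)) / N%:R :> R.
    rewrite exchange_big mulr_suml; apply: eq_bigr => a _.
    by rewrite -mulrBl -sumrB.
  rewrite -mulrDl -big_split /=; apply/andP; split;
    rewrite ler_wpM2r ?invr_ge0//; apply: ler_sum => q _;
    by have [] := frac_below_step M (complete_quotient (x q) k) t01 bt.
- move=> M; apply: (@cvg_sum_ord R M
    (fun a N => empirical x k true a.+1%:R^-1 N - empirical x k (~~ b) (a.+1%:R + t)^-1 N)
    (fun a => gauss_cdf k a.+1%:R^-1 0 - gauss_cdf k (a.+1%:R + t)^-1 0)) => a _.
  by apply: cvgB; apply: IH => //; exact: inv_shift01.
- by move=> M; exact: IH.
- by move=> M; exact: gauss_cdf_step.
- apply: (@squeeze_cvgr _ _ _ _ (fun=> 0) (fun M => 2 * harmonic M)).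
  + near=> M; rewrite gauss_cdf_le// andbT.
    by case/andP: (gauss_cdf01 k (i01 M) z01).
  + exact: cvg_cst.
  + by rewrite -[X in _ --> X](mulr0 2); apply: cvgMl_tmp; exact: cvg_harmonic.
Unshelve. all: by end_near. Qed.

(** * Equidistribution of x_+(q) modulo 1 *)

Lemma xplus_root (R : realType) (r : nat) (p : int) (q : nat) :
  (0 < r)%N -> (0 < q)%N ->
  0 < xplus R r p q /\ r%:R * xplus R r p q ^+ 2 + p%:~R * xplus R r p q = q%:R.
Proof.
move=> r0 q0; rewrite /xplus; set P : R := p%:~R; set s := Num.sqrt _.
have rR : (0 : R) < r%:R by rewrite ltr0n.
have qR : (0 : R) < q%:R by rewrite ltr0n.
have rq : 0 < (r%:R : R) * q%:R by rewrite mulr_gt0.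
have P2 : 0 <= P ^+ 2 by exact: sqr_ge0.
have s2 : s ^+ 2 = P ^+ 2 + 4 * r%:R * q%:R by rewrite sqr_sqrtr//; lra.
have s0 : 0 <= s by exact: sqrtr_ge0.
have Ps : P < s by rewrite ltNge; apply/negP => sP; nra.
split; first by rewrite divr_gt0; lra.
have -> : r%:R * ((- P + s) / (2 * r%:R)) ^+ 2 + P * ((- P + s) / (2 * r%:R)) =
   (s ^+ 2 - P ^+ 2) / (4 * r%:R) by field; rewrite lt0r_neq0.
by rewrite s2; field; rewrite lt0r_neq0.
Qed.

Definition quad (R : realType) (r : nat) (p : int) (y : R) : R :=
  r%:R * y ^+ 2 + p%:~R * y.

(** [quad y - q = (y - x) (r (x + y) + p)], whose last factor is positive because
    [x (r x + p) = q > 0]. This bypasses monotonicity of [quad], which fails near 0 when [p < 0]. *)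
Lemma xplus_lteif (R : realType) (r : nat) (p : int) (q : nat) (b : bool) (y : R) :
  (0 < r)%N -> (0 < q)%N -> 0 <= y ->
  (xplus R r p q < y ?<= if b) = (q%:R < quad r p y ?<= if b).
Proof.
move=> r0 q0 y0; have [x0 xq] := xplus_root R p r0 q0.
have qR : (0 : R) < q%:R by rewrite ltr0n.
have rR : (0 : R) < r%:R by rewrite ltr0n.
set x := xplus R r p q in x0 xq *.
have xp : 0 < r%:R * x + p%:~R.
  rewrite -(pmulr_rgt0 _ x0) (_ : x * _ = r%:R * x ^+ 2 + p%:~R * x); last by ring.
  by rewrite xq.
have c0 : 0 < r%:R * (x + y) + p%:~R.
  have ry : 0 <= r%:R * y by rewrite mulr_ge0.
  lra.
have E : quad r p y - q%:R = (y - x) * (r%:R * (x + y) + p%:~R).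
  by rewrite -xq /quad; ring.
case: b => /=.
  by rewrite -[LHS]subr_ge0 -[RHS]subr_ge0 E pmulr_lge0.
by rewrite -[LHS]subr_gt0 -[RHS]subr_gt0 E pmulr_lgt0.
Qed.

Lemma count_below (R : realType) (b : bool) (tau : R) (n : nat) :
  0 <= tau <= n%:R ->
  tau <= \sum_(j < n) (j%:R < tau ?<= if b)%R%:R <= tau + 1.
Proof.
move=> /andP[t0 tn].
have up m : \sum_(j < m) (j%:R < tau ?<= if b)%R%:R <= tau + 1.
  elim: m => [|m IH]; first by rewrite big_ord0; lra.
  rewrite big_ord_recr /=; case: (boolP (m%:R < _ ?<= if b)) => [/lteifW mt|_].
    rewrite lerD// (le_trans _ mt)// -[X in _ <= X%:R]card_ord -sumr_const.
    by apply: ler_sum => j _; rewrite lern1 leq_b1.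
  by rewrite addr0.
rewrite up andbT.
(* Either every index so far is counted, or the count has already reached [tau]; at [m = n] the
   first case also suffices, as [tau <= n]. *)
suff lo m : m%:R <= \sum_(j < m) (j%:R < tau ?<= if b)%R%:R :> R \/
            tau <= \sum_(j < m) (j%:R < tau ?<= if b)%R%:R.
  by case: (lo n) => // /(le_trans tn).
elim: m => [|m [IH|IH]]; first by left; rewrite big_ord0.
- rewrite big_ord_recr /= -natr1; case: (boolP (m%:R < _ ?<= if b)) => [_|].
    by left; rewrite lerD2r.
  by rewrite -lteifNE => /lteifW tm; right; rewrite addr0 (le_trans tm).
- by right; rewrite big_ord_recr /= (le_trans IH)// lerDl ler0n.
Qed.

(** The value of [quad] at [K] as a natural number; [absz] changes nothing once [K >= |p|]. *)
Definition block (r : nat) (p : int) (K : nat) : nat :=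
  absz (((r * K)%N%:Z + p) * K%:Z).

Lemma blockE (R : realType) (r : nat) (p : int) (K : nat) :
  (0 < r)%N -> (`|p| <= K)%N -> (block r p K)%:R = quad r p (K%:R : R).
Proof.
move=> r0 pK; rewrite -[LHS]/((block r p K)%:Z%:~R) gez0_abs.
  by rewrite /quad intrM intrD /= -!pmulrn natrM; ring.
by rewrite mulr_ge0//; nia.
Qed.

Lemma quadS (R : realType) (r : nat) (p : int) (y t : R) :
  quad r p (y + t) - quad r p y = t * (2 * r%:R * y + r%:R * t + p%:~R).
Proof. by rewrite /quad; ring. Qed.

Lemma abs_int_le (R : realType) (p : int) (K : nat) : (`|p| <= K)%N ->
  - K%:R <= (p%:~R : R) <= K%:R.
Proof.
move=> pK; rewrite -[K%:R]/(K%:Z%:~R) -intrN !ler_int; lia.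
Qed.

Lemma block_lt (r : nat) (p : int) (K : nat) :
  (0 < r)%N -> (`|p| <= K)%N -> (block r p K < block r p K.+1)%N.
Proof. rewrite /block; nia. Qed.

Definition excess (R : realType) (r : nat) (p : int) (b : bool) (t : R) (q : nat) : R :=
  (frac_below b t (Some (xplus R r p q)))%:R - t.

(** On the block the floor is [K], so the event compares [q - F] with [tau]. The count is [tau] up
    to 1, and [tau] falls short of [t] times the block length by [t (r - r t) <= r]. *)
Lemma excess_block (R : realType) (r : nat) (p : int) (b : bool) (t : R) (K : nat) :
  (0 < r)%N -> (`|p| < K)%N -> 0 <= t <= 1 ->
  `|\sum_(block r p K <= q < block r p K.+1) excess r p b t q| <= r%:R + 1.
Proof.
move=> r0 pK t01; have pK' := ltnW pK; have rR : (1 : R) <= r%:R by rewrite ler1n.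
have K0 : (1 : R) <= K%:R by rewrite ler1n (leq_ltn_trans _ pK).
have [_ pKR] := andP (abs_int_le R pK'); have /andP[pKR' _] := abs_int_le R pK'.
have FK := blockE R r0 pK'; have FK1 := blockE R r0 (leqW pK').
rewrite -natr1 in FK1.
have lt := block_lt r0 pK'.
set F := block r p K in FK lt *; set F' := block r p K.+1 in FK1 lt *.
have rK : K%:R <= r%:R * K%:R :> R by rewrite ler_peMl.
have F0 : (0 < F)%N.
  rewrite -(ltr_nat R) FK /quad (_ : _ + _ = (r%:R * K%:R + p%:~R) * K%:R); last by ring.
  have : - K%:R < p%:~R :> R by rewrite -[K%:R]/(K%:Z%:~R) -intrN ltr_int; lia.
  by move=> h; rewrite mulr_gt0; lra.
pose tau := quad r p (K%:R + t) - quad r p (K%:R : R).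
have qS := quadS r p (K%:R : R).
have tauE : tau = t * (2 * r%:R * K%:R + r%:R * t + p%:~R) by exact: qS.
have lenE : (F' - F)%N%:R = 2 * r%:R * K%:R + r%:R + p%:~R :> R.
  by rewrite natrB 1?ltnW// FK1 FK qS mul1r mulr1.
have rt : 0 <= r%:R * t <= r%:R by rewrite mulr_ge0 ?ler_piMr//; lra.
have tau_itv : 0 <= tau <= (F' - F)%N%:R.
  rewrite lenE tauE mulr_ge0 /=; [|lra|lra].
  by rewrite (le_trans (ler_piMl _ _))//; lra.
have ind j : (j < F' - F)%N ->
   frac_below b t (Some (xplus R r p (F + j))) = (j%:R < tau ?<= if b).
  move=> jF; have q0 : (0 < F + j)%N by rewrite addn_gt0 F0.
  have fl : Num.floor (xplus R r p (F + j)) = K%:Z.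
    apply: floor_def; rewrite intrD1 -[K%:~R]/(K%:R); apply/andP; split.
      have := xplus_lteif p false r0 q0 (ler0n R K) => /= /(congr1 negb).
      by rewrite -!leNgt => ->; rewrite -FK ler_nat leq_addr.
    have := xplus_lteif p false r0 q0 (_ : 0 <= K%:R + 1 :> R) => /= ->; last by lra.
    by rewrite -FK1 ltr_nat -ltn_subRL.
  rewrite /frac_below fl -[K%:~R]/(K%:R) lteifBlDl xplus_lteif//; last by lra.
  by rewrite natrD -lteifBrDl FK.
rewrite -{1}[F]add0n big_addn big_mkord.
under eq_bigr => j _ do rewrite /excess addnC ind//.
rewrite sumrB sumr_const card_ord -[t *+ _]mulr_natr lenE.
have := count_below b tau_itv; set S := \sum_(_ < _) _.
have tt : 0 <= t * (r%:R - r%:R * t) <= r%:R.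
  by rewrite mulr_ge0 /= ?(le_trans (ler_piMl _ _)); lra.
by rewrite ler_norml tauE; lra.
Qed.

Lemma exists_block (r : nat) (p : int) (K0 n : nat) :
  (0 < r)%N -> (`|p| <= K0)%N -> (block r p K0 <= n)%N ->
  exists2 K, (K0 <= K)%N & (block r p K <= n < block r p K.+1)%N.
Proof.
move=> r0 pK0; elim: n => [|n IH].
  by rewrite leqn0 => /eqP F0; exists K0; rewrite // -F0 leqnn block_lt.
rewrite leq_eqVlt => /orP[/eqP <-|]; first by exists K0; rewrite ?leqnn ?block_lt.
rewrite ltnS => /IH [K K0K /andP[Kn nK]].
move: nK; rewrite leq_eqVlt => /orP[/eqP nK|nK].
  exists K.+1; first exact: leqW.
  by rewrite nK leqnn block_lt// (leq_trans pK0)// leqW.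
by exists K; rewrite // leqW//.
Qed.

Lemma normr_excess (R : realType) (r : nat) (p : int) (b : bool) (t : R) (m n : nat) :
  0 <= t <= 1 -> (m <= n)%N ->
  `|\sum_(m <= q < n) excess r p b t q| <= n%:R - m%:R.
Proof.
move=> t01 mn; rewrite (le_trans (ler_norm_sum _ _ _))//.
rewrite -natrB// -sumr_const_nat ler_sum// => q _.
by rewrite /excess; case: frac_below; rewrite ler_norml /=; lra.
Qed.

Lemma excess_blocks (R : realType) (r : nat) (p : int) (b : bool) (t : R) (K0 K : nat) :
  (0 < r)%N -> (`|p| < K0)%N -> (K0 <= K)%N -> 0 <= t <= 1 ->
  (block r p K0 <= block r p K)%N /\
  `|\sum_(block r p K0 <= q < block r p K) excess r p b t q| <= (r%:R + 1) * K%:R.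
Proof.
move=> r0 pK0 K0K t01; elim: K K0K => [|K IH].
  by rewrite leqn0 => /eqP K00; rewrite K00 in pK0.
rewrite leq_eqVlt => /orP[/eqP <-|].
  by rewrite leqnn big_geq// normr0 mulr_ge0 ?addr_ge0.
rewrite ltnS => K0K; have [F1 F2] := IH K0K.
have pK : (`|p| < K)%N by rewrite (leq_trans pK0).
have lt := block_lt r0 (ltnW pK).
split; first by rewrite (leq_trans F1)// ltnW.
rewrite (big_cat_nat F1 (ltnW lt)) /= (le_trans (ler_normD _ _))//.
have := excess_block b r0 pK t01; rewrite -natr1 => h.
by rewrite mulrDr mulr1 lerD.
Qed.

(** Full blocks cost at most [(r + 1) K], the unfinished one at most its length [2 r K + r + p], and
    [K] is of order [sqrt N]. *)
Lemma excess_sublinear (R : realType) (r : nat) (p : int) (b : bool) (t e : R) :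
  (0 < r)%N -> 0 <= t <= 1 -> 0 < e ->
  exists C : R, forall N : nat,
    `|\sum_(1 <= q < N.+1) excess r p b t q| <= C + e * N%:R.
Proof.
move=> r0 t01 e0; have rR : (1 : R) <= r%:R by rewrite ler1n.
(* [D] exceeds [(r + 1) + 2 r], the total coefficient of [K] in these two costs. *)
pose P := `|p|%N; pose D : R := 3 * r%:R + 2; pose d := e / D.
have D0 : 0 < D by rewrite /D; lra.
have d0 : 0 < d by rewrite divr_gt0.
have dD : d * D = e by rewrite /d divfK// lt0r_neq0.
have P0 : 0 <= P%:R :> R by [].
pose F0 : R := (block r p P.+1)%:R.
have F00 : 0 <= F0 by [].
exists (F0 + r%:R + P%:R + D * (P%:R + 1 / (4 * d)) + e) => N.
have d4 : 0 <= 1 / (4 * d) by rewrite divr_ge0; lra.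
have NR : 0 <= N%:R :> R by [].
have eN : 0 <= e * N%:R by rewrite mulr_ge0//; lra.
have DP : 0 <= D * (P%:R + 1 / (4 * d)) by rewrite mulr_ge0; lra.
case: (leqP (block r p P.+1) N.+1) => [h|h]; last first.
  rewrite (le_trans (normr_excess _ _ _ t01 _))//.
  have : N.+1%:R <= F0 by rewrite ler_nat ltnW.
  by rewrite -natr1; lra.
have [K PK /andP[KN NK]] := exists_block r0 (leqnSn P) h.
have [b1 b2] := excess_blocks b r0 (ltnSn P) PK t01.
have pK : (P <= K)%N by rewrite ltnW.
have bp : (1 <= block r p P.+1)%N.
  by rewrite (leq_ltn_trans _ (block_lt r0 (leqnn _))).
rewrite (big_cat_nat bp h) /= (big_cat_nat b1 KN) /=.
rewrite (le_trans (ler_normD _ _))// (le_trans (lerD (lexx _) (ler_normD _ _)))//.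
have e1 := normr_excess r p b t01 bp.
have e3 := normr_excess r p b t01 KN.
have FK := blockE R r0 pK; have FK1 := blockE R r0 (leqW pK).
have NK' : N.+1%:R <= (block r p K.+1)%:R :> R by rewrite ler_nat ltnW.
have KN' : (block r p K)%:R <= N.+1%:R :> R by rewrite ler_nat.
have /andP[p1 p2] := abs_int_le R (leqnn P).
have KP : P%:R <= K%:R :> R by rewrite ler_nat.
rewrite -natr1 in FK1; have qS := quadS r p (K%:R : R) 1.
have rK : K%:R <= r%:R * K%:R :> R by rewrite ler_peMl.
have sq : (K%:R - P%:R) ^+ 2 <= N%:R + 1 :> R.
  rewrite natr1 (le_trans _ KN')// FK /quad.
  by nra.
(* [y <= d y^2 + 1 / (4 d)] replaces the square root of [N] by a small multiple of [N]. *)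
have amgm : K%:R - P%:R <= d * (N%:R + 1) + 1 / (4 * d).
  apply: le_trans (_ : _ <= d * (K%:R - P%:R) ^+ 2 + 1 / (4 * d)) _; last first.
    by rewrite lerD2r ler_wpM2l// ltW.
  rewrite -subr_ge0 (_ : _ - _ = d * (K%:R - P%:R - 1 / (2 * d)) ^+ 2).
    by rewrite mulr_ge0 ?sqr_ge0// ltW.
  by field; rewrite lt0r_neq0.
have DK : D * K%:R <= e * N%:R + e + D * (P%:R + 1 / (4 * d)).
  rewrite -dD (_ : _ + _ = D * (d * (N%:R + 1) + 1 / (4 * d) + P%:R)); last by ring.
  by rewrite ler_wpM2l//; lra.
rewrite FK1 in NK'; rewrite FK in e3.
by move: DK; rewrite /D /F0; lra.
Qed.

Lemma xplus_equidistributed (R : realType) (r : nat) (p : int) (b : bool) (t : R) :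
  (0 < r)%N -> 0 <= t <= 1 ->
  empirical (fun q => xplus R r p q.+1) 0 b t N @[N --> \oo] --> t.
Proof.
move=> r0 t01; apply/cvgrPdist_le => e e0.
have e2 : 0 < e / 2 by lra.
have [C HC] := excess_sublinear p b r0 t01 e2.
near=> N.
have N0 : (0 : R) < N%:R by rewrite ltr0n; near: N; exact: nbhs_infty_gt.
have CN : C <= e / 2 * N%:R.
  rewrite -ler_pdivrMl//; near: N; exact: nbhs_infty_ger.
have -> : t - empirical (fun q => xplus R r p q.+1) 0 b t N =
    - ((\sum_(1 <= q < N.+1) excess r p b t q) / N%:R).
  rewrite big_add1 big_mkord /excess sumrB sumr_const card_ord.
  rewrite -[t *+ _]mulr_natr /empirical.
  by rewrite mulrBl mulfK ?lt0r_neq0// opprB.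
rewrite normrN normf_div [X in _ / X]gtr0_norm// ler_pdivrMr//.
by have := HC N; lra.
Unshelve. all: by end_near. Qed.

(** * Averaging over the index of the digit *)

Lemma pi_probE (R : realType) (r : nat) (p : int) (A N n : nat) : (0 < A)%N ->
  pi_prob R r p A N n =
  (\sum_(s < n) (empirical (fun q => xplus R r p q.+1) s true A%:R^-1 N
     - empirical (fun q => xplus R r p q.+1) s true A.+1%:R^-1 N)) / n%:R.
Proof.
move=> A0; rewrite /pi_prob /Defs.uniform_prob card_prod !card_ord natrM invfM mulrA.
congr (_ / _); rewrite -sum1_card natr_sum big_mkcond /=.
pose f (q : 'I_N) (s : 'I_n) : R :=
  (partial_quotient (xplus R r p q.+1) s.+1 == Some A%:Z)%:R.
rewrite (eq_bigr (fun i => f i.1 i.2)); last first.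
  by move=> i _; rewrite inE /f; case: (_ == _).
rewrite -(pair_bigA _ f) /= exchange_big mulr_suml; apply: eq_bigr => s _.
rewrite /empirical -mulrBl -sumrB; congr (_ / _); apply: eq_bigr => q _.
(* The digit of index [s + 1] is read off the complete quotient of index [s], so the ordinals below
   [n] yield the digits 1 to [n]. *)
by rewrite -digit_event.
Qed.

Lemma pi_prob_cvg (R : realType) (r : nat) (p : int) (A n : nat) :
  (0 < r)%N -> (0 < A)%N ->
  pi_prob R r p A N n @[N --> \oo] -->
  (\sum_(s < n) (gauss_cdf s A%:R^-1 0 - gauss_cdf s A.+1%:R^-1 0)) / n%:R.
Proof.
move=> r0 A0; under eq_fun do rewrite pi_probE//.
apply: cvgMr_tmp; apply: (@cvg_sum_ord R n
  (fun s N => empirical (fun q => xplus R r p q.+1) s true A%:R^-1 N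
     - empirical (fun q => xplus R r p q.+1) s true A.+1%:R^-1 N)
  (fun s => gauss_cdf s A%:R^-1 0 - gauss_cdf s A.+1%:R^-1 0)) => s _.
by apply: cvgB; apply: empirical_cvg; rewrite ?inv_nat01// => b t t01;
  exact: xplus_equidistributed.
Qed.

(** Both sides are the logarithm of [(A + 1)^2 / (A (A + 2))]. *)
Lemma gauss_law (R : realType) (A : nat) : (0 < A)%N ->
  ln (1 + A%:R^-1) - ln (1 + A.+1%:R^-1) = ln (1 + 1 / (A%:R * (A%:R + 2))) :> R.
Proof.
move=> A0; have AR : (0 : R) < A%:R by rewrite ltr0n.
have i0 : 0 < (A%:R^-1 : R) by rewrite invr_gt0.
have j0 : 0 < (A%:R + 1 : R)^-1 by rewrite invr_gt0; lra.
rewrite -natr1 -ln_div ?posrE; try lra.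
by congr ln; field; rewrite !lt0r_neq0//; lra.
Qed.

Theorem mainTheorem2 (R : realType) (r : nat) (p : int) (A : nat)
    (r_ge1 : (1 <= r)%N) (A_ge1 : (1 <= A)%N) :
  (forall n : nat, (1 <= n)%N -> cvgn (fun N : nat => pi_prob R r p A N n)) /\
  (fun n : nat => limn (fun N : nat => pi_prob R r p A N n)
     - ln (1 + 1 / (A%:R * (A%:R + 2))) / ln 2)
    =O_\oo (fun n : nat => 1 / n%:R : R).
Proof.
have cv n := @pi_prob_cvg R r p A n r_ge1 A_ge1.
split; first by move=> n _; apply: cvgP (cv n).
(* 16 = 2 * 8: each [s] brings two errors [(7/8)^s], at [1/A] and [1/(A + 1)], and the geometric
   series of ratio 7/8 has sum 8. *)
apply/eqO_exP; exists 16 => //; near=> n.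
have n0 : (0 : R) < n%:R by rewrite ltr0n; near: n; exact: nbhs_infty_gt.
rewrite (cvg_lim _ (cv n))//; set g := _ / ln 2.
rewrite (_ : _ - g = (\sum_(s < n)
  (gauss_cdf s A%:R^-1 0 - gauss_cdf s A.+1%:R^-1 0 - g)) / n%:R).
  rewrite !normf_div normr1 mulrA mulr1 ler_wpM2r ?invr_ge0//.
  rewrite (le_trans (ler_norm_sum _ _ _))//.
  apply: le_trans (_ : _ <= \sum_(s < n) 2 * (7 / 8) ^+ s) _.
    apply: ler_sum => s _.
    have h1 := gauss_kuzmin s (inv_nat01 R A_ge1).
    have h2 := gauss_kuzmin s (inv_nat01 R (ltn0Sn A)).
    rewrite /g -gauss_law// mulrBl.
    rewrite (_ : _ - _ = (gauss_cdf s A%:R^-1 0 - ln (1 + A%:R^-1) / ln 2)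
       - (gauss_cdf s A.+1%:R^-1 0 - ln (1 + A.+1%:R^-1) / ln 2)); last by ring.
    by rewrite (le_trans (ler_normB _ _))// mulr2n mulrDl mul1r lerD.
  rewrite -mulr_sumr.
  have E m : \sum_(s < m) (7 / 8) ^+ s = 8 * (1 - (7 / 8) ^+ m) :> R.
    elim: m => [|m IH]; first by rewrite big_ord0 expr0; ring.
    by rewrite big_ord_recr /= IH exprS; field.
  have : 0 <= (7 / 8) ^+ n :> R by rewrite exprn_ge0.
  rewrite E; lra.
by rewrite [in RHS]sumrB sumr_const card_ord -[g *+ _]mulr_natr mulrBl mulfK// lt0r_neq0.
Unshelve. all: by end_near. Qed.
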